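(* Let $X$, $Y$ be real Hilbert spaces, $K\subset X$, $\widetilde K\subset X$, $A:X\to X$, $G:X\to X$, $j:X\times X\to\mathbb{R}$, $\pi:X\to Y$, $\{\lambda_n\}_{n\in\mathbb{N}}\subset\mathbb{R}$, and let $g,g_n:X\to\mathbb{R}$, $h,h_n:Y\to\mathbb{R}$ ($n\in\mathbb{N}$). Assume: (1) $K$ and $\widetilde K$ are nonempty, closed, convex subsets of $X$ and $K\subset\widetilde K$. (2) There exist $m>0$, $M>0$ such that $(Au-Av,u-v)_X\ge m\|u-v\|_X^2$ and $\|Au-Av\|_X\le M\|u-v\|_X$ for all $u,v\in X$. (3) For all $\eta\in X$, $j(\eta,\cdot):X\to\mathbb{R}$ is convex and lower semicontinuous, and there exists $\alpha\ge0$ such that $j(\eta_1,v_2)-j(\eta_1,v_1)+j(\eta_2,v_1)-j(\eta_2,v_2)\le\alpha\|\eta_1-\eta_2\|_X\|v_1-v_2\|_X$ for all $\eta_1,\eta_2,v_1,v_2\in X$. (4) There exist $\beta,\gamma\ge0$ such that $j(\eta,v_1)-j(\eta,v_2)\le(\beta+\gamma\|\eta\|_X)\|v_1-v_2\|_X$ for all $\eta,v_1,v_2\in X$. (5) $m>\alpha$ and $m>\gamma$. (6) For any sequences $\{\eta_n\},\{u_n\}\subset X$ with $\eta_n\rightharpoonup\eta$ and $u_n\rightharpoonup u$ in $X$, one has $\limsup\,(j(\eta_n,v)-j(\eta_n,u_n))\le j(\eta,v)-j(\eta,u)$ for all $v\in X$. (7) $\pi$ is linear and continuous, i.e. there exists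 $c_0>0$ with $\|\pi v\|_Y\le c_0\|v\|_X$ for all $v\in X$; and for any sequence $\{v_n\}\subset X$ with $v_n\rightharpoonup v$ in $X$ one has $\pi v_n\to\pi v$ in $Y$. (8) $G$ is monotone and Lipschitz continuous. (9) $(Gu,v-u)_X\le0$ for all $u\in\widetilde K$, $v\in K$; and if $u\in\widetilde K$ satisfies $(Gu,v-u)_X=0$ for all $v\in K$, then $u\in K$. (10) $\lambda_n>0$ for all $n\in\mathbb{N}$ and $\lambda_n\to0$ as $n\to\infty$. (11) The function $g$ and, for each $n\in\mathbb{N}$, the function $g_n$ is continuous on $X$ (for strong convergence), takes only nonnegative values, and maps bounded sets in $X$ into bounded sets in $\mathbb{R}$. (12) The function $h$ and, for each $n\in\mathbb{N}$, the function $h_n$ is weakly (sequentially) lower semicontinuous and coercive on $Y$; that is, with $\varphi$ denoting any one of these functions, $y_k\rightharpoonup y$ in $Y$ implies $\liminf_{k}\varphi(y_k)\ge\varphi(y)$, and $\|y_k\|_Y\to\infty$ implies $\varphi(y_k)\to\infty$. (13) For all sequences $\{u_n\}\subset X$ and $u\in X$: $u_n\to u$ in $X$ implies $g_n(u_n)\to g(u)$. (14) For all sequences $\{f_n\}\subset Y$ and $f\in Y$: $f_n\rightharpoonup f$ in $Y$ implies $\liminf h_n(f_n)\ge h(f)$. (15) For all sequences $\{f_n\}\subset Y$: $\|f_n\|_Y\to\infty$ implies $h_n(f_n)\to\infty$. (16) $h_n(f)\to h(f)$ for all $f\in Y$. Let $\{(u_n^*,f_n^* )\}$ be a sequence such that,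 for each $n\in\mathbb{N}$, $(u_n^*,f_n^* )$ is a solution of Problem $\mathcal{Q}_n$. Then there exist a subsequence of $\{(u_n^*,f_n^* )\}$, again denoted by $\{(u_n^*,f_n^* )\}$, and an element $(u^*,f^* )\in X\times Y$ such that $$f_n^*\rightharpoonup f^*\ \text{in } Y,\qquad u_n^*\to u^*\ \text{in } X\qquad\text{as } n\to\infty,$$ and $(u^*,f^* )$ is a solution of Problem $\mathcal{Q}$.
   Context: The symbols $\rightharpoonup$ and $\to$ denote weak and strong convergence, respectively; limits are taken as $n\to\infty$. Set of admissible pairs $\mathcal{V}_{ad}$: the set of $(u,f)\in K\times Y$ such that $(Au,v-u)_X+j(u,v)-j(u,u)\ge(f,\pi v-\pi u)_Y$ for all $v\in K$. Cost functionals: $\mathcal{L}(u,f)=g(u)+h(f)$ and $\mathcal{L}_n(u,f)=g_n(u)+h_n(f)$ for all $u\in X$, $f\in Y$. Problem $\mathcal{Q}$: find $(u^*,f^* )\in\mathcal{V}_{ad}$ such that $\mathcal{L}(u^*,f^* )=\min_{(u,f)\in\mathcal{V}_{ad}}\mathcal{L}(u,f)$. Set of admissible pairs $\mathcal{V}_{ad}^n$: the set of $(u,f)\in\widetilde K\times Y$ such that $(Au,v-u)_X+\frac{1}{\lambda_n}(Gu,v-u)_X+j(u,v)-j(u,u)\ge(f,\pi v-\pi u)_Y$ for all $v\in\widetilde K$. Problem $\mathcal{Q}_n$: find $(u_n^*,f_n^* )\in\mathcal{V}_{ad}^n$ such that $\mathcal{L}_n(u_n^*,f_n^* )=\min_{(u,f)\in\mathcal{V}_{ad}^n}\mathcal{L}_n(u,f)$.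 *)

(* Defs.v *)
From HB Require Import structures.
From mathcomp Require Import all_boot all_order all_algebra.
From mathcomp Require Import sesquilinear.
From mathcomp Require Import all_classical all_reals.
From mathcomp Require Import ereal topology normedtype sequences convex.

Set Implicit Arguments.
Unset Strict Implicit.
Unset Printing Implicit Defensive.

Import Order.TTheory GRing.Theory Num.Theory.
Import numFieldNormedType.Exports.

Local Open Scope classical_set_scope.
Local Open Scope ring_scope.

HB.mixin Record CompleteNormedModule_isHilbert (R : realType) V
    of CompleteNormedModule R V := {
  inner : {dot V for idfun} ;
  inner_norm : forall x : V, inner x x = `|x| ^+ 2
}.

#[short(type="hilbertType")]
HB.structure Definition Hilbert (R : realType) :=
  {V of CompleteNormedModule R V & CompleteNormedModule_isHilbert R V}.

(* Weak convergence in the sense of the topological dual. *)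
Definition weak_cvg (R : realType) (X : normedModType R)
    (x : nat -> X) (l : X) : Prop :=
  forall phi : {linear X -> R^o}, continuous phi ->
    phi (x n) @[n --> \oo] --> phi l.

(* The inferior limit is taken in the extended reals, so that no boundedness
   of the sequence is presupposed. *)
Definition weakly_seq_lsc (R : realType) (Y : normedModType R)
    (phi : Y -> R) : Prop :=
  forall (y : nat -> Y) (l : Y), weak_cvg y l ->
    ((phi l)%:E <= limn_einf (fun k => (phi (y k))%:E))%E.

Definition coercive (R : realType) (Y : normedModType R)
    (phi : Y -> R) : Prop :=
  forall y : nat -> Y, `|y k| @[k --> \oo] --> +oo ->
    phi (y k) @[k --> \oo] --> +oo.

Definition monotone_operator (R : realType) (X : hilbertType R)
    (G : X -> X) : Prop :=
  forall u v : X, 0 <= inner (G u - G v) (u - v).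

Definition maps_bounded_to_bounded (R : realType) (X : normedModType R)
    (g : X -> R) : Prop :=
  forall B : set X, bounded_set B -> bounded_set (g @` B : set R^o).

Definition Vad (R : realType) (X Y : hilbertType R) (K : set X) (A : X -> X)
    (j : X -> X -> R) (pi : X -> Y) : set (X * Y) :=
  [set p | let: (u, f) := p in K u /\
    forall v, K v ->
      inner (A u) (v - u) + j u v - j u u >= inner f (pi v - pi u)].

Definition Vad_penalized (R : realType) (X Y : hilbertType R) (Kt : set X)
    (A G : X -> X) (lambda : R) (j : X -> X -> R) (pi : X -> Y) : set (X * Y) :=
  [set p | let: (u, f) := p in Kt u /\
    forall v, Kt v ->
      inner (A u) (v - u) + lambda^-1 * inner (G u) (v - u) + j u v - j u u
        >= inner f (pi v - pi u)].

Definition cost (R : realType) (X Y : Type) (g : X -> R) (h : Y -> R) :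
    X * Y -> R :=
  fun p => g p.1 + h p.2.

Definition minimizer (R : realType) (T : Type) (L : T -> R) (V : set T)
    (p : T) : Prop :=
  V p /\ forall q, V q -> L p <= L q.

(* Main.v *)
Require Import Defs.
From HB Require Import structures.
From mathcomp Require Import all_boot all_order all_algebra.
From mathcomp Require Import sesquilinear.
From mathcomp Require Import all_classical all_reals.
From mathcomp Require Import ereal topology normedtype sequences convex.
From mathcomp Require Import interval_inference ring lra.

Set Implicit Arguments.
Unset Strict Implicit.
Unset Printing Implicit Defensive.

Import Order.TTheory GRing.Theory Num.Theory.
Import numFieldNormedType.Exports.

Local Open Scope classical_set_scope.
Local Open Scope ring_scope.

(** The theorem is a compactness argument for the optimal pairs of the penalized
    problems.

    Testing a penalized inequality with a point of [K] makes the penalty term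
    nonpositive, so it can be dropped.  Strong monotonicity of [A] beats the
    growth of [j] (this is where [m > gamma] enters) and bounds the states in
    terms of the data; hence bounded data give weakly convergent states along a
    subsequence.  The same inequality makes the penalty at most a vanishing multiple
    of a bounded quantity, and Minty's trick turns this into membership of the
    weak limit in [K].  Testing with the weak limit itself then upgrades weak to strong
    convergence, and every term of the inequality passes to the limit.  This is
    [penalized_limit], the core of the proof.

    The optimal controls are bounded because they do at least as well as the
    pairs formed by the zero control and a corresponding state, whose costs
    converge; coercivity uniform in the index concludes.  So a subsequence of
    optimal pairs converges to an admissible pair.  It is optimal: an
    arbitrary admissible pair [(w, f)] is approached by penalized states for
    the same control [f], which exist by [penalized_solution_exists] and can
    only converge to [w], by [Vad_unique]; the costs then compare by lower
    semicontinuity.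

    The Hilbert space theory rests on one minimization result, [exists_prox].
    It yields the Riesz representation, orthogonal projections, the weak
    closedness of closed convex sets and, iterated as a contraction, the
    solvability of the quasivariational inequalities.  Weak sequential
    compactness, [bounded_weak_subseq], comes from a limit along an ultrafilter
    represented by Riesz.  Assumptions that speak of whole sequences are used
    along subsequences by filling the gaps, see [splice]. *)

(** * Inner products *)

Section InnerProduct.
Context (R : realType) (V : hilbertType R).
Implicit Types (x y z : V) (a : R).

Lemma innerC x y : inner x y = inner y x.
Proof. by rewrite (hermC (@inner R V)) expr0 mul1r. Qed.

Lemma innerDl x y z : inner (x + y) z = inner x z + inner y z.
Proof. by rewrite (@linearDl _ _ _ _ _ _ (@inner R V)). Qed.

Lemma innerNl x z : inner (- x) z = - inner x z.
Proof. by rewrite (@linearNl _ _ _ _ _ _ (@inner R V)). Qed.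

Lemma innerZl a x z : inner (a *: x) z = a * inner x z.
Proof. exact: (@linearZl_LR _ _ _ _ _ _ (@inner R V)). Qed.

Lemma inner0l z : inner 0 z = 0.
Proof. by rewrite -(subrr z) innerDl innerNl subrr. Qed.

Lemma inner0r z : inner z 0 = 0.
Proof. by rewrite innerC inner0l. Qed.

Lemma innerDr x y z : inner z (x + y) = inner z x + inner z y.
Proof. by rewrite ![inner z _]innerC innerDl. Qed.

Lemma innerNr x z : inner z (- x) = - inner z x.
Proof. by rewrite ![inner z _]innerC innerNl. Qed.

Lemma innerZr a x z : inner z (a *: x) = a * inner z x.
Proof. by rewrite ![inner z _]innerC innerZl. Qed.

Definition innerE :=
  (innerDl, innerDr, innerNl, innerNr, innerZl, innerZr, inner0l, inner0r).

Lemma ler_inner x y : inner x y <= `|x| * `|y|.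
Proof.
have [->|x0] := eqVneq x 0; first by rewrite inner0l normr0 mul0r.
have [->|y0] := eqVneq y 0; first by rewrite inner0r normr0 mulr0.
have nx : 0 < `|x| by rewrite normr_gt0.
have ny : 0 < `|y| by rewrite normr_gt0.
(* this combination vanishes in the equality case, x and y positively parallel *)
have ge0 := sqr_ge0 `| `|y| *: x - `|x| *: y |.
have : 0 <= 2 * (`|x| * `|y|) * (`|x| * `|y| - inner x y).
  rewrite (le_trans ge0)// le_eqVlt; apply/orP; left; apply/eqP.
  by rewrite -inner_norm !innerE !inner_norm (innerC y x); ring.
by rewrite pmulr_rge0 ?subr_ge0// !mulr_gt0.
Qed.

Lemma ler_norm_inner x y : `|inner x y| <= `|x| * `|y|.
Proof.
by rewrite ler_norml ler_inner andbT lerNl -innerNl (le_trans (ler_inner _ _))// normrN.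
Qed.

Lemma normB_sqr x y : `|x - y| ^+ 2 = `|x| ^+ 2 - 2 * inner x y + `|y| ^+ 2.
Proof. by rewrite -!inner_norm !innerE (innerC y x); ring. Qed.

End InnerProduct.

(** The first-order step of every variational argument below: an inequality at
    all small [t] along a segment, divided by [t], survives as [t] tends to 0. *)
Lemma ge0_of_small_perturbation (R : realType) (a b : R) :
  (forall t, 0 < t -> t <= 1 -> 0 <= a + t * b) -> 0 <= a.
Proof.
move=> H; rewrite leNgt; apply/negP => a0.
have b0 : 0 < b by have := H 1 ltr01 (lexx _); lra.
have ab : 0 < - a / (2 * b) by rewrite divr_gt0 ?mulr_gt0// oppr_gt0.
have [h|/ltW h] := leP (- a / (2 * b)) 1.
  have := H _ ab h; have -> : a + - a / (2 * b) * b = a / 2.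
    by field; rewrite gt_eqF.
  by lra.
have := H _ ltr01 (lexx _); rewrite ler_pdivlMr ?mul1r in h; last by lra.
by lra.
Qed.

(** * Proximal points *)

Lemma convex_set_comb (R : realType) (V : lmodType R) (C : set V) x y (t : R) :
  @convex_set R V C -> 0 <= t -> t <= 1 -> C x -> C y ->
  C (t *: x + (1 - t) *: y).
Proof.
move=> cC t0 t1 Cx Cy; have := cC x y (Itv01 t0 t1) (mem_set Cx) (mem_set Cy).
by move/set_mem.
Qed.

Lemma convex_function_comb (R : realType) (V : lmodType R) (phi : V -> R) x y
    (t : R) :
  @convex_function R V setT phi -> 0 <= t -> t <= 1 ->
  phi (t *: x + (1 - t) *: y) <= t * phi x + (1 - t) * phi y.
Proof. by move=> cp t0 t1; exact: (cp (Itv01 t0 t1) x y (in_setT _) (in_setT _)). Qed.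

(** Squared distances, because that is what the parallelogram law controls for
    a minimizing sequence. *)
Lemma cvgn_of_sqr_rate (R : realType) (V : completeNormedModType R)
    (x : nat -> V) (r : nat -> R) :
  r n @[n --> \oo] --> 0 -> (forall n m, `|x n - x m| ^+ 2 <= r n + r m) ->
  cvgn x.
Proof.
move=> r0 xr; apply/cauchy_cvgP/cauchy_exP => e e0 /=.
have e4 : 0 < e ^+ 2 / 4 by rewrite divr_gt0// exprn_gt0.
have /cvgrPdist_lt/(_ _ e4) [N _ HN] := r0.
exists (x N); exists N => // n /= Nn; rewrite -ball_normE /=.
have := HN N (leqnn N); have := HN n Nn; rewrite /= !sub0r !normrN => h1 h2.
rewrite -(@ltr_pXn2r _ 2)// ?nnegrE ?(ltW e0)//; apply: le_lt_trans (xr _ _) _.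
by have := ler_norm (r n); have := ler_norm (r N); lra.
Qed.

Section Prox.
Context (R : realType) (V : hilbertType R).

(** The minimizer over [C] of half the squared norm plus [phi].  The functional
    is bounded below because [phi] decreases at most linearly; a minimizing
    sequence is Cauchy by the parallelogram law and convexity; the inequality
    is the first-order optimality condition, where only the quadratic part is
    differentiated and [phi] is handled by convexity. *)
Lemma exists_prox (C : set V) (phi : V -> R) (c : R) :
  C !=set0 -> closed C -> @convex_set R V C ->
  (forall x y (t : R), 0 <= t -> t <= 1 ->
     phi (t *: x + (1 - t) *: y) <= t * phi x + (1 - t) * phi y) ->
  (forall x y, phi x - phi y <= c * `|x - y|) ->
  exists2 u, C u & forall v, C v -> 0 <= inner u (v - u) + phi v - phi u.
Proof.
move=> [w Cw] closedC convC convphi lipphi.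
pose J v : R := `|v| ^+ 2 / 2 + phi v.
have Jlb v : phi 0 - c ^+ 2 / 2 <= J v.
  have := lipphi 0 v; rewrite sub0r normrN /J.
  have := sqr_ge0 (`|v| - c); nra.
pose d := inf (J @` C).
have hinf : has_inf (J @` C).
  split; first by exists (J w); exists w.
  by exists (phi 0 - c ^+ 2 / 2) => _ [v _ <-].
have Jd v : C v -> d <= J v.
  by move=> Cv; apply: ge_inf; [exact: hinf.2|exists v].
have /choice [x Hx] n : exists v, C v /\ J v < d + n.+1%:R^-1.
  have n0 : (0 : R) < n.+1%:R^-1 by rewrite invr_gt0.
  by have [_ [v Cv <-] Jv] := inf_adherent n0 hinf; exists v.
(* parallelogram law at the midpoint, which lies in C and so has value at
   least the infimum *)
have dist2 n m : `|x n - x m| ^+ 2 <= 4 * (n.+1%:R^-1 + m.+1%:R^-1).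
  have h0 : (0 : R) <= 1 / 2 by lra.
  have h1 : 1 / 2 <= (1 : R) by lra.
  have Cmid := convex_set_comb convC h0 h1 (Hx n).1 (Hx m).1.
  have := Jd _ Cmid; have := convphi (x n) (x m) _ h0 h1.
  have [_ Jn] := Hx n; have [_ Jm] := Hx m; move: Jn Jm; rewrite /J normB_sqr.
  move: (phi (_ + _)) => p.
  rewrite -(inner_norm (_ + _)) !innerE !inner_norm (innerC (x m)).
  by move: n.+1%:R^-1 m.+1%:R^-1 => a b; lra.
pose r n : R := 4 * n.+1%:R^-1.
have r0 : r n @[n --> \oo] --> 0.
  have h4 : (4 : R) @[n --> \oo] --> (4 : R) by exact: cvg_cst.
  by rewrite -(mulr0 4); exact: cvgM h4 cvg_harmonic.
have xr n m : `|x n - x m| ^+ 2 <= r n + r m by rewrite -mulrDr; exact: dist2.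
have /cvg_ex [u xu] := cvgn_of_sqr_rate r0 xr.
have Cu : C u by apply: (closed_cvg _ _ _ _ xu) => //; apply: nearW => n; exact: (Hx n).1.
have Ju : J u <= d.
  have Jx : J (x n) @[n --> \oo] --> J u.
    apply: cvgD.
      have h2 : (2^-1 : R) @[n --> \oo] --> (2^-1 : R) by exact: cvg_cst.
      exact: cvgM (cvgM (cvg_norm xu) (cvg_norm xu)) h2.
    apply/cvgrPdist_le => e e0.
    have ec : 0 < e / (`|c| + 1) by rewrite divr_gt0// ltr_pwDr.
    have /cvgrPdist_le/(_ _ ec) := xu; apply: filterS => n h.
    have hc : `|c| * `|u - x n| <= e.
      move: h; rewrite ler_pdivlMr ?ltr_pwDr//; apply: le_trans.
      by rewrite mulrC ler_wpM2l// lerDl.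
    have h1 := lipphi u (x n); have h2 := lipphi (x n) u.
    rewrite (distrC (x n)) in h2.
    have : c * `|u - x n| <= `|c| * `|u - x n| by rewrite ler_wpM2r// ler_norm.
    by rewrite ler_norml; lra.
  have dx : d + n.+1%:R^-1 @[n --> \oo] --> d.
    by rewrite -[X in _ --> X]addr0; apply: cvgD; [exact: cvg_cst|exact: cvg_harmonic].
  by apply: (ler_cvg_to Jx dx); apply: nearW => n; apply/ltW; exact: (Hx n).2.
exists u => // v Cv.
apply: (@ge0_of_small_perturbation _ _ (`|v - u| ^+ 2 / 2)) => t t0 t1.
have := le_trans Ju (Jd _ (convex_set_comb convC (ltW t0) t1 Cv Cu)).
have := convphi v u _ (ltW t0) t1; rewrite /J; move: (phi (_ + _)) => p.
rewrite normB_sqr -(inner_norm (_ + _)) !innerE !inner_norm (innerC u v) => h1 h2.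
rewrite -(pmulr_rge0 _ t0); nra.
Qed.

End Prox.

(** * Riesz representation and weak convergence *)

Lemma cvg_of_dist_le (R : realType) (T : Type) (F : set_system T)
    {FF : Filter F} (W : normedModType R) (a : T -> W) (b : T -> R) (l : W) :
  b n @[n --> F] --> 0 -> (forall n, `|l - a n| <= b n) -> a n @[n --> F] --> l.
Proof.
move=> b0 ab; apply/cvgrPdist_lt => e e0.
have /cvgrPdist_lt/(_ _ e0) := b0; apply: filterS => n.
by rewrite sub0r normrN; apply: le_lt_trans; exact: le_trans (ab n) (ler_norm _).
Qed.

Section WeakConvergence.
Context (R : realType) (V : hilbertType R).
Implicit Types (x y z l : V).

(** The proximal point of [- L] on the whole space: without constraint the
    variational inequality becomes an equality. *)
Lemma riesz (L : V -> R) (c : R) :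
  (forall x y, L (x + y) = L x + L y) -> (forall a x, L (a *: x) = a * L x) ->
  (forall x, L x <= c * `|x|) -> exists z, forall x, L x = inner z x.
Proof.
move=> LD LZ Lb.
have LN x : L (- x) = - L x by rewrite -scaleN1r LZ mulN1r.
have [|||||z _ Hz] := @exists_prox R V setT (fun x => - L x) c.
- by exists 0.
- exact: closedT.
- by move=> x y t _ _; exact: in_setT.
- by move=> x y t _ _; rewrite LD !LZ; lra.
- by move=> x y; rewrite distrC opprK addrC -LN -LD.
exists z => x.
have := Hz (z + x) Logic.I; have := Hz (z - x) Logic.I.
by rewrite !LD LN !innerE; lra.
Qed.

(** The inner product with a fixed vector as a continuous linear form, the kind
    of test that weak convergence asks for. *)
Definition inner_with z : V -> R^o := fun x => inner z x.

Fact inner_with_linear z : linear (inner_with z).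
Proof. by move=> a x y; rewrite /inner_with !innerE. Qed.

HB.instance Definition _ z :=
  GRing.isLinear.Build R V R^o *:%R (inner_with z) (inner_with_linear z).

Lemma cvg_inner (T : Type) (F : set_system T) (FF : Filter F) (f g : T -> V) x y :
  f n @[n --> F] --> x -> g n @[n --> F] --> y ->
  inner (f n) (g n) @[n --> F] --> inner x y.
Proof.
move=> fx gy.
have fg0 : `|f n - x| * `|g n| @[n --> F] --> 0.
  rewrite -(mul0r `|y|) -(@normr0 R V) -(subrr x).
  by apply: cvgM; [apply: cvg_norm; apply: cvgB => //; exact: cvg_cst|exact: cvg_norm].
have xg0 : `|x| * `|g n - y| @[n --> F] --> 0.
  rewrite -(mulr0 `|x|) -(@normr0 R V) -(subrr y).
  by apply: cvgM; [exact: cvg_cst|apply: cvg_norm; apply: cvgB => //; exact: cvg_cst].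
have fg_xg0 : `|f n - x| * `|g n| + `|x| * `|g n - y| @[n --> F] --> 0.
  by rewrite -(addr0 0); exact: cvgD fg0 xg0.
apply: (cvg_of_dist_le fg_xg0) => n.
have -> : inner x y - inner (f n) (g n) =
    - (inner (f n - x) (g n) + inner x (g n - y)) by rewrite !innerE; ring.
by rewrite normrN (le_trans (ler_normD _ _))// lerD// ler_norm_inner.
Qed.

Lemma weak_cvgP (x : nat -> V) l :
  weak_cvg x l <-> forall z, inner z (x n) @[n --> \oo] --> inner z l.
Proof.
split=> [xl z|xl phi cphi].
  apply: (xl (inner_with z)) => y.
  by apply: cvg_inner; [exact: cvg_cst|exact: cvg_id].
have /linear_boundedP/pinfty_ex_gt0 [c _ phic] : bounded_near phi (nbhs (0 : V)).
  by apply/linear_bounded_continuous.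
have [||y|z phiE] := @riesz phi c.
- by move=> ? ?; rewrite linearD.
- by move=> ? ?; rewrite linearZ.
- by apply: le_trans (phic y); exact: ler_norm.
by rewrite phiE; under eq_fun do rewrite phiE; exact: xl.
Qed.

Lemma weak_cvg_of_cvg (x : nat -> V) l : x n @[n --> \oo] --> l -> weak_cvg x l.
Proof. by move=> xl phi cphi; apply: continuous_cvg => //; exact: cphi. Qed.

End WeakConvergence.

(** * Subsequences and weak sequential compactness *)

Lemma subseq_ge (s : nat -> nat) n : increasing_seq s -> (n <= s n)%N.
Proof.
move=> /increasing_seqP incs; elim: n => // n /leq_ltn_trans; apply.
exact: incs.
Qed.

Lemma cvg_subseq (s : nat -> nat) : increasing_seq s -> s @ \oo --> \oo.
Proof.
move=> incs P [N _ NP]; exists N => // n /= Nn; apply: NP => /=.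
exact: leq_trans Nn (subseq_ge n incs).
Qed.

Lemma increasing_seq_comp (s t : nat -> nat) :
  increasing_seq s -> increasing_seq t -> increasing_seq (s \o t).
Proof. by move=> incs inct n m /=; exact: etrans (incs _ _) (inct _ _). Qed.

Lemma exists_increasing_seq (P : nat -> nat -> Prop) :
  (forall k N, exists2 n, (N <= n)%N & P k n) ->
  exists2 s : nat -> nat, increasing_seq s & forall k, P k (s k).
Proof.
move=> H.
have /choice [f Hf] (kN : nat * nat) : exists n, (kN.2 <= n)%N /\ P kN.1 n.
  by have [n ? ?] := H kN.1 kN.2; exists n.
pose s := fix s k := if k is k'.+1 then f (k, (s k').+1) else f (0, 0)%N.
exists s; last by case=> [|k]; [exact: (Hf (0, 0)%N).2|exact: (Hf (k.+1, _)).2].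
by apply/increasing_seqP => k; exact: (Hf (k.+1, (s k).+1)).1.
Qed.

Section WeakCompactness.
Context (R : realType) (V : hilbertType R).
Implicit Types (x : nat -> V) (y z l : V).

Lemma weak_cvg_subseq x l (s : nat -> nat) :
  increasing_seq s -> weak_cvg x l -> weak_cvg (x \o s) l.
Proof.
move=> incs xl phi cphi; exact: (cvg_comp _ _ (cvg_subseq incs) (xl phi cphi)).
Qed.

Lemma ultra_cvg_bounded (G : set_system nat) (a : nat -> R) (B : R) :
  UltraFilter G -> (forall n, `|a n| <= B) -> exists l : R, a n @[n --> G] --> l.
Proof.
move=> GU aB; have [|l [_ al]] := @segment_compact R (- B) B (a @ G) _.
  apply: (@filterS _ G _ setT) => [n _|]; last exact: filterT.
  by rewrite /= in_itv /= -ler_norml.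
exists l => U lU; have [//|GnU] := in_ultra_setVsetC (a @^-1` U) GU.
by have [t []] := al (~` U) U GnU lU.
Qed.

(** The proximal point of minus the inner product with [y] is the nearest point
    to [y]; on a subspace both signs of a direction are allowed. *)
Lemma projection_subspace (E : set V) y : E 0 -> closed E ->
  (forall a z w, E z -> E w -> E (a *: z + w)) ->
  exists2 p, E p & forall w, E w -> inner (y - p) w = 0.
Proof.
move=> E0 clE linE.
have [||||p Ep Hp] := @exists_prox R V E (fun v => - inner y v) `|y| _ clE.
- by exists 0.
- move=> u v t /set_mem Eu /set_mem Ev; apply/mem_set; apply: (linE) => //.
  by rewrite -[_ *: v]addr0; exact: linE.
- by move=> u v t _ _; rewrite !innerE; lra.
- move=> u v; have := ler_inner y (v - u); rewrite (distrC v) !innerE; lra.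
exists p => // w Ew.
have := Hp (1 *: p + w) (linE _ _ _ Ep Ew).
have := Hp ((-1) *: w + p) (linE _ _ _ Ew Ep).
by rewrite !innerE; lra.
Qed.

(** For a bounded sequence, convergence to 0 against a vector is stable under
    small changes of that vector, uniformly in the index. *)
Lemma closed_inner_cvg (d : nat -> V) (B : R) : (forall n, `|d n| <= B) ->
  closed [set y | inner (d n) y @[n --> \oo] --> 0].
Proof.
move=> dB y cly /=; apply/cvgrPdist_lt => e e0.
have B0 : 0 <= B := le_trans (normr_ge0 _) (dB 0%N).
have eB : 0 < e / 2 / (B + 1) by rewrite divr_gt0//; lra.
have [z [/= dz yz]] := cly _ (nbhsx_ballx y _ eB).
have e2 : 0 < e / 2 by lra.
have /cvgrPdist_lt/(_ _ e2) := dz; apply: filterS => n.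
rewrite !sub0r !normrN => dnz.
have -> : inner (d n) y = inner (d n) z + inner (d n) (y - z).
  by rewrite -innerDr addrC subrK.
apply: le_lt_trans (ler_normD _ _) _; have := ler_norm_inner (d n) (y - z).
have := dB n; move: yz; rewrite -ball_normE /= ltr_pdivlMr; last by lra.
have := normr_ge0 (d n); have := normr_ge0 (y - z); nra.
Qed.

(** Along an ultrafilter finer than the Frechet filter every scalar sequence
    [inner (x n) y] converges, and its limit is linear and bounded in [y], hence
    of the form [inner l y].  A subsequence is then chosen that converges to [l]
    against each of the countably many vectors [x i].  The vectors against which
    it converges form a closed subspace, which contains all [x i] and also their
    orthogonal complement, so it is everything. *)
Lemma bounded_weak_subseq x (B : R) : (forall n, `|x n| <= B) ->
  exists2 s : nat -> nat, increasing_seq s & exists l, weak_cvg (x \o s) l.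
Proof.
move=> xB; have B0 : 0 <= B := le_trans (normr_ge0 _) (xB 0%N).
have [G [GU ooG]] := ultraFilterLemma (F := \oo) _.
have /choice [c Hc] y : exists l : R, inner (x n) y @[n --> G] --> l.
  apply: (@ultra_cvg_bounded _ _ (B * `|y|)) => n.
  by rewrite (le_trans (ler_norm_inner _ _))// ler_wpM2r.
have cvg_uniq (a : nat -> R) (u v : R) :
    a n @[n --> G] --> u -> a n @[n --> G] --> v -> u = v.
  by move=> au av; exact: (cvg_unique (@Rhausdorff R) au av).
have [|||l Hl] := @riesz R V c B.
- move=> y z; apply: cvg_uniq (Hc (y + z)) _.
  have -> : (fun n => inner (x n) (y + z)) = (fun n => inner (x n) y + inner (x n) z).
    by apply/funext => n; rewrite innerDr.
  by apply: cvgD; exact: Hc.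
- move=> a y; apply: cvg_uniq (Hc (a *: y)) _.
  have -> : (fun n => inner (x n) (a *: y)) = (fun n => a * inner (x n) y).
    by apply/funext => n; rewrite innerZr.
  by apply: cvgM; [exact: cvg_cst|exact: Hc].
- move=> y; apply: (ler_cvg_to (Hc y) (cvg_cst (B * `|y|))); apply: nearW => n.
  by rewrite (le_trans (ler_inner _ _))// ler_wpM2r.
have [k N|s incs Hs] := @exists_increasing_seq (fun k n =>
    forall i, (i <= k)%N -> `|inner l (x i) - inner (x n) (x i)| < k.+1%:R^-1).
  (* members of the ultrafilter meet every tail, and finite intersections of
     them are again members *)
  have near_i i : G [set n | `|inner l (x i) - inner (x n) (x i)| < k.+1%:R^-1].
    by have /cvgrPdist_lt := Hc (x i); rewrite Hl; apply; rewrite invr_gt0.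
  have near_k j : G [set n | forall i, (i <= j)%N ->
      `|inner l (x i) - inner (x n) (x i)| < k.+1%:R^-1].
    elim: j => [|j IH].
      by apply: filterS (near_i 0%N) => n h i; rewrite leqn0 => /eqP ->.
    apply: filterS2 IH (near_i j.+1) => n h1 h2 i.
    by rewrite leq_eqVlt => /orP[/eqP ->//|]; exact: h1.
  have GN : G [set n | (N <= n)%N] by apply: ooG; exists N.
  have [n [h1 h2]] := filter_ex (filterI GN (near_k k)).
  by exists n.
exists s => //; exists l.
pose d n := x (s n) - l.
pose E := [set y | inner (d n) y @[n --> \oo] --> 0].
have dB n : `|d n| <= B + `|l| by rewrite (le_trans (ler_normB _ _))// lerD.
have clE : closed E := closed_inner_cvg dB.
have E0 : E 0 by rewrite /E /=; under eq_fun do rewrite inner0r; exact: cvg_cst.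
have linE a z w : E z -> E w -> E (a *: z + w).
  rewrite /E /= => Ez Ew.
  have -> : (fun n => inner (d n) (a *: z + w)) =
      (fun n => a * inner (d n) z + inner (d n) w).
    by apply/funext => n; rewrite innerDr innerZr.
  have -> : (0 : R) = a * 0 + 0 by rewrite mulr0 addr0.
  by apply: cvgD => //; apply: cvgM => //; exact: cvg_cst.
have Ex i : E (x i).
  apply/cvgrPdist_lt => e e0.
  have /cvgrPdist_lt/(_ _ e0) := @cvg_harmonic R.
  move=> [N _ HN]; exists (maxn N i) => // k /= ; rewrite geq_max => /andP[Nk ik].
  have := HN _ Nk; rewrite /= !sub0r !normrN ger0_norm ?invr_ge0//.
  by apply: lt_trans; rewrite innerDl innerNl distrC; exact: Hs.
suff ET y : E y.
  apply/weak_cvgP => z; have := ET z; rewrite /E /= => h.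
  rewrite -[X in _ --> X]add0r.
  have -> : (fun n => inner z ((x \o s) n)) = (fun n => inner (d n) z + inner z l).
    by apply/funext => n; rewrite innerDl innerNl (innerC l) subrK innerC.
  by apply: cvgD => //; exact: cvg_cst.
have [p Ep Hp] := projection_subspace y E0 clE linE.
have cp : c (y - p) = 0.
  apply: cvg_uniq (Hc (y - p)) _.
  have -> : (fun n => inner (x n) (y - p)) = (fun=> 0).
    by apply/funext => n; rewrite innerC Hp.
  exact: cvg_cst.
have Eyp : E (y - p).
  rewrite /E /=.
  have -> : (fun n => inner (d n) (y - p)) = (fun=> 0).
    by apply/funext => n; rewrite innerDl innerNl -Hl cp innerC Hp// subr0.
  exact: cvg_cst.
by have := linE 1 _ _ Eyp Ep; rewrite scale1r subrK.
Qed.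

End WeakCompactness.

(** * Solvability of quasivariational inequalities *)

(** The projection [p] of the weak limit [l] satisfies a linear inequality at
    each [x n], which passes to the limit and reads [`|l - p| ^+ 2 <= 0]. *)
Lemma weak_closed_convex (R : realType) (V : hilbertType R) (C : set V)
    (x : nat -> V) (l : V) :
  closed C -> @convex_set R V C -> (forall n, C (x n)) -> weak_cvg x l -> C l.
Proof.
move=> clC convC Cx /weak_cvgP xl.
have [|||p Cp Hp] := @exists_prox R V C (fun v => - inner l v) `|l| _ clC convC.
- by exists (x 0%N).
- by move=> u v t _ _; rewrite !innerE; lra.
- by move=> u v; have := ler_inner l (v - u); rewrite (distrC v) !innerE; lra.
have : 0 <= inner (p - l) (l - p).
  have h : inner (p - l) (x n) - inner (p - l) p @[n --> \oo] --> inner (p - l) (l - p).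
    by rewrite innerDr innerNr; apply: cvgB; [exact: xl|exact: cvg_cst].
  apply: (ler_cvg_to (cvg_cst 0) h); apply: nearW => n.
  by have := Hp _ (Cx n); rewrite !innerE; lra.
rewrite -(opprB p l) innerNr inner_norm oppr_ge0 => h.
have : `|p - l| == 0 by rewrite -sqrf_eq0 eq_le h sqr_ge0.
by rewrite normr_eq0 subr_eq0 => /eqP <-.
Qed.

Lemma contraction_fixed_point (R : realType) (V : completeNormedModType R)
    (S : V -> V) (q : R) :
  0 <= q -> q < 1 -> (forall x y, `|S x - S y| <= q * `|x - y|) ->
  exists x, x = S x.
Proof.
move=> q0 q1 Sq.
have SU : set_fun [set: V] [set: V] S by [].
have [|//|//|x _ xS] := @banach_fixed_point R V setT (mkfun SU).
- by exists (NngNum q0); split => // -[x y] _; exact: Sq.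
- by exists 0.
by exists x.
Qed.

(** For small [rho] the solution is a fixed point of the map sending [w] to the
    proximal point of [rho j(w, .)] at [w - rho T w + rho z].  The explicit step
    contracts by [1 - rho (m + alpha) / 2], the dependence of [j] on its first
    argument costs [rho alpha], and [alpha < m] leaves a factor below 1. *)
Lemma quasivariational_solution (R : realType) (V : hilbertType R) (C : set V)
    (T : V -> V) (j : V -> V -> R) (z : V) (m L alpha beta gamma : R) :
  C !=set0 -> closed C -> @convex_set R V C ->
  (forall u v, m * `|u - v| ^+ 2 <= inner (T u - T v) (u - v)) ->
  (forall u v, `|T u - T v| <= L * `|u - v|) ->
  (forall eta, @convex_function R V setT (j eta)) ->
  (forall eta1 eta2 v1 v2 : V,
     j eta1 v2 - j eta1 v1 + j eta2 v1 - j eta2 v2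
       <= alpha * `|eta1 - eta2| * `|v1 - v2|) ->
  (forall eta v1 v2 : V,
     j eta v1 - j eta v2 <= (beta + gamma * `|eta|) * `|v1 - v2|) ->
  0 <= alpha -> alpha < m ->
  exists2 u, C u &
    forall v, C v -> inner z (v - u) <= inner (T u) (v - u) + j u v - j u u.
Proof.
move=> C0 clC convC Tm TL jconv jalpha jlip a0 am.
(* enlarging the Lipschitz constant beyond m makes rho * (m + alpha) at most 1 *)
pose L1 := `|L| + m.
have L1m : m <= L1 by rewrite lerDr.
have L1p : 0 < L1 by lra.
have L2p : 0 < L1 ^+ 2 by rewrite exprn_gt0.
have TL1 u v : `|T u - T v| <= L1 * `|u - v|.
  apply: le_trans (TL u v) _; rewrite ler_wpM2r//.
  by have := ler_norm L; rewrite /L1; lra.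
have [rho rho0 rhoL] : exists2 rho, 0 < rho & rho * L1 ^+ 2 = m - alpha.
  exists ((m - alpha) / L1 ^+ 2); first by rewrite divr_gt0// subr_gt0.
  by rewrite mulfVK// gt_eqF.
have rhoma : rho * (m + alpha) <= 1.
  rewrite -(ler_pM2r L2p) mul1r mulrAC rhoL -subr_sqr.
  have : m ^+ 2 <= L1 ^+ 2 by rewrite ler_sqr ?nnegrE; lra.
  by have := sqr_ge0 alpha; lra.
pose q := 1 - rho * (m - alpha) / 2.
pose b w := w - rho *: T w + rho *: z.
have /choice [S HS] w : exists u, C u /\ forall v, C v ->
    0 <= inner u (v - u) + (rho * j w v - inner (b w) v) - (rho * j w u - inner (b w) u).
  have [||u Cu Hu] := @exists_prox R V C
      (fun v => rho * j w v - inner (b w) v)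
      (rho * (beta + gamma * `|w|) + `|b w|) C0 clC convC; last by exists u.
  - move=> u v t t0 t1; have := convex_function_comb u v (jconv w) t0 t1.
    by rewrite -(ler_pM2l rho0) !innerE; lra.
  - move=> u v; have := jlip w u v; rewrite -(ler_pM2l rho0).
    by have := ler_inner (b w) (v - u); rewrite (distrC v) innerDr innerNr; lra.
have [||w1 w2|u uS] := @contraction_fixed_point R V S q.
- by rewrite /q; have := mulr_ge0 (ltW rho0) a0; lra.
- rewrite /q; have : 0 < rho * (m - alpha) by rewrite mulr_gt0// subr_gt0.
  lra.
- have [C1 h1] := HS w1; have [C2 h2] := HS w2.
  have {}h1 := h1 _ C2; have {}h2 := h2 _ C1.
  set e := w1 - w2 - rho *: (T w1 - T w2).
  have eb : e = b w1 - b w2.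
    by rewrite /e /b scalerBr !opprD [RHS]addrACA subrr addr0 [RHS]addrACA.
  have eq : `|e| <= (q - rho * alpha) * `|w1 - w2|.
    have Tdm := Tm w1 w2; have TdL := TL1 w1 w2.
    rewrite -(@ler_pXn2r _ 2)// ?nnegrE ?normr_ge0//; last first.
      by apply: mulr_ge0 => //; rewrite /q; lra.
    rewrite /e normB_sqr innerZr normrZ (gtr0_norm rho0) (innerC _ (T _ - _)).
    have : `|T w1 - T w2| ^+ 2 <= L1 ^+ 2 * `|w1 - w2| ^+ 2.
      by rewrite -exprMn ler_sqr ?nnegrE ?mulr_ge0// ltW.
    move: Tdm; move: `|w1 - w2| `|T w1 - T w2| (inner _ _) => a t i ai tL.
    have g1 : rho * (m * a ^+ 2) <= rho * i by rewrite ler_pM2l.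
    have g2 : rho ^+ 2 * t ^+ 2 <= rho * (m - alpha) * a ^+ 2.
      have := ler_wpM2l (sqr_ge0 rho) tL; rewrite -rhoL.
      by congr (_ <= _); ring.
    have g3 : 0 <= (rho * (m + alpha) / 2) ^+ 2 * a ^+ 2.
      by rewrite mulr_ge0// sqr_ge0.
    rewrite !exprMn /q. lra.
  have h := jalpha w1 w2 (S w1) (S w2); rewrite -(ler_pM2l rho0) in h.
  have eS := ler_inner e (S w1 - S w2).
  have SS : `|S w1 - S w2| ^+ 2 <= inner e (S w1 - S w2) +
     rho * alpha * `|w1 - w2| * `|S w1 - S w2|.
    by rewrite -inner_norm eb; move: h1 h2; rewrite !innerE; lra.
  have := normr_ge0 (S w1 - S w2); rewrite le_eqVlt => /orP[/eqP <-|Sp].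
    by rewrite mulr_ge0// /q; have := mulr_ge0 (ltW rho0) a0; lra.
  rewrite -(ler_pM2r Sp) -expr2; have := ler_wpM2r (ltW Sp) eq; lra.
exists u; first by rewrite uS; exact: (HS u).1.
move=> v Cv; have := (HS u).2 v Cv; rewrite -uS /b !innerE => h.
by rewrite -(ler_pM2l rho0); lra.
Qed.

(** * Limits of penalized solutions *)

Section LimitsSuperiorInferior.
Context (R : realType).

Lemma limn_esup_le_near (a : nat -> R) (l e : R) :
  (limn_esup (fun n => (a n)%:E) <= l%:E)%E -> 0 < e ->
  \forall n \near \oo, a n < l + e.
Proof.
move=> al e0.
have : (limn_esup (fun n => (a n)%:E) < (l + e)%:E)%E.
  by rewrite (le_lt_trans al)// lte_fin ltrDl.
move=> /ereal_inf_lt [_ [P ooP <-] supP]; apply: filterS ooP => n Pn.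
rewrite -lte_fin; apply: le_lt_trans supP; apply: ereal_sup_ubound.
by exists n.
Qed.

Lemma limn_einf_ge_near (a : nat -> R) (l e : R) :
  (l%:E <= limn_einf (fun n => (a n)%:E))%E -> 0 < e ->
  \forall n \near \oo, l - e < a n.
Proof.
move=> al e0.
have : (limn_esup (fun n => (- a n)%:E) <= (- l)%:E)%E.
  by rewrite -leeN2 EFinN oppeK.
move=> /limn_esup_le_near /(_ e0); apply: filterS => n; lra.
Qed.

Lemma le_of_cvg_limn_esup (a c : nat -> R) (l k : R) :
  c n @[n --> \oo] --> k -> (forall n, c n <= a n) ->
  (limn_esup (fun n => (a n)%:E) <= l%:E)%E -> k <= l.
Proof.
move=> ck ca al; apply/ler_addgt0Pr => e e0.
apply: (ler_cvg_to ck (cvg_cst (l + e))).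
have := limn_esup_le_near al e0; apply: filterS => n /ltW; exact: le_trans.
Qed.

End LimitsSuperiorInferior.

Lemma cvg_inner_weak_strong (R : realType) (V : hilbertType R) (f g : nat -> V)
    (x y : V) (B : R) :
  (forall n, `|f n| <= B) -> weak_cvg f x -> g n @[n --> \oo] --> y ->
  inner (f n) (g n) @[n --> \oo] --> inner x y.
Proof.
move=> fB /weak_cvgP fx gy.
have h0 : inner (f n) (g n - y) @[n --> \oo] --> 0.
  have b0 : B * `|g n - y| @[n --> \oo] --> 0.
    have -> : (0 : R) = B * `|y - y| by rewrite subrr normr0 mulr0.
    by apply: cvgM; [exact: cvg_cst|apply: cvg_norm; apply: cvgB => //; exact: cvg_cst].
  apply: (cvg_of_dist_le b0) => n; rewrite sub0r normrN.
  by rewrite (le_trans (ler_norm_inner _ _))// ler_wpM2r.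
have -> : (fun n => inner (f n) (g n)) =
    (fun n => inner (f n) (g n - y) + inner y (f n)).
  by apply/funext => n; rewrite (innerC y) !innerE subrK.
by rewrite -[X in _ --> X]add0r (innerC x); apply: cvgD => //; exact: fx.
Qed.

Section PenalizedLimit.
Context (R : realType) (X Y : hilbertType R) (K Kt : set X) (A G : X -> X)
  (j : X -> X -> R) (pi : {linear X -> Y}) (m M beta gamma c0 : R).
Context (K_neq0 : K !=set0)
  (Kt_closed : closed Kt) (Kt_convex : @convex_set R X Kt)
  (K_sub_Kt : K `<=` Kt)
  (A_strongly_monotone : forall u v : X,
     inner (A u - A v) (u - v) >= m * `|u - v| ^+ 2)
  (A_lipschitz : forall u v : X, `|A u - A v| <= M * `|u - v|)
  (M_gt0 : 0 < M) (gamma_ge0 : 0 <= gamma)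
  (j_beta_gamma : forall eta v1 v2 : X,
     j eta v1 - j eta v2 <= (beta + gamma * `|eta|) * `|v1 - v2|)
  (m_gt0 : 0 < m) (m_gt_gamma : m > gamma)
  (j_limsup : forall (eta_ u_ : nat -> X) (eta u : X),
     weak_cvg eta_ eta -> weak_cvg u_ u ->
     forall v : X,
       (limn_esup (fun n => (j (eta_ n) v - j (eta_ n) (u_ n))%:E)
          <= (j eta v - j eta u)%:E)%E)
  (c0_gt0 : 0 < c0) (pi_bounded : forall v : X, `|pi v| <= c0 * `|v|)
  (pi_weak_strong : forall (v_ : nat -> X) (v : X),
     weak_cvg v_ v -> pi (v_ n) @[n --> \oo] --> pi v)
  (G_monotone : monotone_operator G) (G_lipschitz : lipschitz G)
  (G_le0 : forall u v : X, Kt u -> K v -> inner (G u) (v - u) <= 0)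
  (G_eq0 : forall u : X, Kt u ->
     (forall v : X, K v -> inner (G u) (v - u) = 0) -> K u).

(** On [K] the penalty has a favourable sign and disappears. *)
Lemma penalized_ineq_on_K l u f v : 0 < l ->
  Vad_penalized Kt A G l j pi (u, f) -> K v ->
  inner f (pi v - pi u) <= inner (A u) (v - u) + (j u v - j u u).
Proof.
move=> l0 [Ku Hu] Kv; have := Hu v (K_sub_Kt Kv).
have : l^-1 * inner (G u) (v - u) <= 0.
  by rewrite pmulr_rle0 ?invr_gt0//; exact: G_le0.
lra.
Qed.

(** Tested with a fixed point of [K], the inequality bounds [m `|u - v0|] by a
    constant plus [gamma `|u - v0|]; the bound depends neither on the penalty
    parameter nor on the solution. *)
Lemma penalized_bounded F : exists B, forall l u f, 0 < l ->
  Vad_penalized Kt A G l j pi (u, f) -> `|f| <= F -> `|u| <= B.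
Proof.
have [v0 Kv0] := K_neq0.
pose D := `|A v0| + beta + gamma * `|v0| + c0 * F.
exists (`|v0| + `|D| / (m - gamma)) => l u f l0 Hu fF.
have h := penalized_ineq_on_K l0 Hu Kv0.
have hA := A_strongly_monotone u v0.
have hj := j_beta_gamma u v0 u.
have hp : - (c0 * F * `|u - v0|) <= inner f (pi v0 - pi u).
  rewrite lerNl -innerNr opprB; apply: le_trans (ler_inner _ _) _.
  rewrite -linearB; apply: (@le_trans _ _ (F * (c0 * `|u - v0|))); last lra.
  by apply: ler_pM.
have hv := ler_inner (A v0) (v0 - u).
have hu : `|u| <= `|v0| + `|u - v0| by rewrite -{1}(subrK v0 u) addrC ler_normD.
have hgu := ler_wpM2l gamma_ge0 hu.
rewrite (distrC v0) in hj hv.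
have mg : 0 < m - gamma by rewrite subr_gt0.
apply: (le_trans hu); rewrite lerD2l ler_pdivlMr//.
have hD := ler_norm D; have a0 := normr_ge0 (u - v0).
have hgu2 := ler_wpM2r a0 hgu.
have : m * `|u - v0| ^+ 2 <= (D + gamma * `|u - v0|) * `|u - v0|.
  by move: hA h hp hv hj hgu2; rewrite !innerE /D; lra.
have [->|an] := eqVneq `|u - v0| 0; first by rewrite mul0r.
have ap : 0 < `|u - v0| by rewrite lt_neqAle eq_sym an.
rewrite expr2 mulrA ler_pM2r//; lra.
Qed.

(** Minty's trick: the inequality with [G v], tested on the segment from [u]
    towards a point of [K], gives in the limit the inequality with [G u].  Together
    with the sign of the penalty this is the equality that forces [u] into [K]. *)
Lemma minty_penalty u (Ku : Kt u) :
  (forall v, Kt v -> inner (G v) (u - v) <= 0) -> K u.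
Proof.
move=> H; apply: G_eq0 => // v Kv; apply/eqP; rewrite eq_le G_le0//=.
have /pinfty_ex_gt0 [L L0 GL] := G_lipschitz.
apply: (@ge0_of_small_perturbation _ _ (L * `|v - u| ^+ 2)) => t t0 t1.
pose w := t *: v + (1 - t) *: u.
have Kw : Kt w := convex_set_comb Kt_convex (ltW t0) t1 (K_sub_Kt Kv) Ku.
have wu : w - u = t *: (v - u).
  by rewrite /w scalerBl scale1r scalerBr addrA addrAC addrK.
have Guw : `|G u - G w| <= L * (t * `|v - u|).
  have := GL (u, w) (conj Logic.I Logic.I).
  by rewrite /= (distrC u) wu normrZ (gtr0_norm t0).
have h := H w Kw; rewrite -opprB wu innerNr innerZr oppr_le0 pmulr_rge0// in h.
have := ler_inner (G w - G u) (v - u); rewrite (distrC (G w)).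
have := ler_wpM2r (normr_ge0 (v - u)) Guw.
rewrite innerDl innerNl; lra.
Qed.

Section WeaklyConvergent.
Context (lambda : nat -> R) (u : nat -> X) (f : nat -> Y) (ul : X) (fl : Y) (F : R).
Context (lambda_gt0 : forall n, 0 < lambda n)
  (lambda_cvg0 : lambda n @[n --> \oo] --> 0)
  (u_sol : forall n, Vad_penalized Kt A G (lambda n) j pi (u n, f n))
  (f_bounded : forall n, `|f n| <= F)
  (f_weak : weak_cvg f fl) (u_weak : weak_cvg u ul).

(** By the inequality, [inner (G (u n)) (u n - v)] is at most [lambda n] times a
    constant; monotonicity replaces [G (u n)] by the fixed vector [G v], and then
    weak convergence is enough to pass to the limit. *)
Lemma penalized_weak_limit_in_K : K ul.
Proof.
have Ktl : Kt ul := weak_closed_convex Kt_closed Kt_convex (fun n => (u_sol n).1) u_weak.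
apply: minty_penalty => // v Kv.
have [B0 HB0] := penalized_bounded F.
pose B := `|B0| + `|v|.
have uB n : `|u n| <= `|B0|.
  apply: le_trans (ler_norm _).
  exact: HB0 (lambda_gt0 n) (u_sol n) (f_bounded n).
pose D := (`|A 0| + M * B + (`|beta| + gamma * B) + F * c0) * B.
have GD n : inner (G v) (u n - v) <= lambda n * D.
  have B00 := normr_ge0 B0; have v0 := normr_ge0 v.
  have u0 := normr_ge0 (u n); have uBn := uB n.
  have B1 : 0 <= B by rewrite /B; lra.
  have vu : `|v - u n| <= B.
    by rewrite (le_trans (ler_normB _ _))// /B; lra.
  have F0 : 0 <= F := le_trans (normr_ge0 _) (f_bounded n).
  have Au : `|A (u n)| <= `|A 0| + M * B.
    have := A_lipschitz (u n) 0; rewrite subr0 => h.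
    rewrite -(subrK (A 0) (A (u n))) (le_trans (ler_normD _ _))// addrC lerD2l.
    by rewrite (le_trans h)// ler_wpM2l ?(ltW M_gt0)// (le_trans uBn)// lerDl.
  have hA : inner (A (u n)) (v - u n) <= (`|A 0| + M * B) * B.
    by rewrite (le_trans (ler_inner _ _))// ler_pM.
  have hj : j (u n) v - j (u n) (u n) <= (`|beta| + gamma * B) * B.
    apply: le_trans (j_beta_gamma _ _ _) _.
    apply: (@le_trans _ _ ((`|beta| + gamma * B) * `|v - u n|)).
      by rewrite ler_wpM2r// lerD ?ler_norm// ler_wpM2l// (le_trans uBn)// lerDl.
    by rewrite ler_wpM2l// addr_ge0// mulr_ge0.
  have hp : inner (f n) (pi (u n) - pi v) <= F * c0 * B.
    rewrite -linearB -mulrA (le_trans (ler_inner _ _))// ler_pM//.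
    by rewrite (le_trans (pi_bounded _))// ler_wpM2l ?(ltW c0_gt0)// distrC.
  have hG : (lambda n)^-1 * inner (G (u n)) (u n - v) <= D.
    have [_ Hn] := u_sol n; have := Hn v Kv; move: hA hj hp; rewrite /D !innerE; lra.
  rewrite mulrC ler_pdivrMr// mulrC in hG.
  have := G_monotone (u n) v; move: hG; rewrite !innerE; lra.
have c1 : inner (G v) (u n) - inner (G v) v @[n --> \oo]
    --> inner (G v) ul - inner (G v) v.
  by apply: cvgB; [move/weak_cvgP : u_weak; exact|exact: cvg_cst].
have c2 : lambda n * D @[n --> \oo] --> 0.
  by rewrite -(mul0r D); apply: cvgM => //; exact: cvg_cst.
rewrite innerDr innerNr; apply: (ler_cvg_to c1 c2); apply: nearW => n.
by have := GD n; rewrite innerDr innerNr.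
Qed.

(** The weak limit is itself an admissible test point.  Testing with it,
    [m `|ul - u n| ^+ 2] is bounded by a difference of values of [j] whose limit
    superior is at most 0, plus terms that vanish because [pi] turns weak into
    strong convergence. *)
Lemma penalized_strong_limit : u n @[n --> \oo] --> ul.
Proof.
have Kl := penalized_weak_limit_in_K.
pose r n := inner (f n) (pi (u n) - pi ul) - inner (A ul) (u n - ul).
have r0 : r n @[n --> \oo] --> 0.
  have -> : (0 : R) = inner fl (pi ul - pi ul) - inner (A ul) (ul - ul).
    by rewrite !subrr !inner0r subrr.
  apply: cvgB.
    apply: (cvg_inner_weak_strong f_bounded f_weak); apply: cvgB; last exact: cvg_cst.
    exact: pi_weak_strong.
  have -> : (fun n => inner (A ul) (u n - ul)) =
     (fun n => inner (A ul) (u n) - inner (A ul) ul).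
    by apply/funext => n; rewrite !innerE.
  rewrite innerDr innerNr; apply: cvgB; last exact: cvg_cst.
  by move/weak_cvgP : u_weak; exact.
have est n : m * `|ul - u n| ^+ 2 <= (j (u n) ul - j (u n) (u n)) + r n.
  have := penalized_ineq_on_K (lambda_gt0 n) (u_sol n) Kl.
  have := A_strongly_monotone (u n) ul.
  by rewrite /r distrC !innerE; lra.
apply/cvgrPdist_lt => e e0.
have me : 0 < m * e ^+ 2 / 2 by rewrite divr_gt0// mulr_gt0// exprn_gt0.
have := limn_esup_le_near (j_limsup u_weak u_weak ul) me.
have /cvgrPdist_lt/(_ _ me) := r0; apply: filterS2 => n h1 h2.
rewrite sub0r normrN in h1; have h3 := le_lt_trans (ler_norm _) h1.
rewrite -(@ltr_pXn2r _ 2)// ?nnegrE ?(ltW e0)// -(ltr_pM2l m_gt0).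
by apply: le_lt_trans (est n) _; lra.
Qed.

Lemma penalized_limit_Vad : Vad K A j pi (ul, fl).
Proof.
split; first exact: penalized_weak_limit_in_K.
move=> v Kv; have uul := penalized_strong_limit.
have Aul : A (u n) @[n --> \oo] --> A ul.
  have b0 : M * `|ul - u n| @[n --> \oo] --> 0.
    have -> : (0 : R) = M * `|ul - ul| by rewrite subrr normr0 mulr0.
    by apply: cvgM; [exact: cvg_cst|apply: cvg_norm; apply: cvgB => //; exact: cvg_cst].
  exact: (cvg_of_dist_le b0).
have c1 : inner (f n) (pi v - pi (u n)) - inner (A (u n)) (v - u n) @[n --> \oo]
    --> inner fl (pi v - pi ul) - inner (A ul) (v - ul).
  apply: cvgB.
    apply: (cvg_inner_weak_strong f_bounded f_weak); apply: cvgB; first exact: cvg_cst.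
    exact: pi_weak_strong.
  by apply: cvg_inner => //; apply: cvgB => //; exact: cvg_cst.
have h n : inner (f n) (pi v - pi (u n)) - inner (A (u n)) (v - u n) <=
    j (u n) v - j (u n) (u n).
  by have := penalized_ineq_on_K (lambda_gt0 n) (u_sol n) Kv; lra.
have := le_of_cvg_limn_esup c1 h (j_limsup u_weak u_weak v); lra.
Qed.

End WeaklyConvergent.

Lemma penalized_limit (lambda : nat -> R) (u : nat -> X) (f : nat -> Y) (fl : Y)
    (F : R) :
  (forall n, 0 < lambda n) -> lambda n @[n --> \oo] --> 0 ->
  (forall n, Vad_penalized Kt A G (lambda n) j pi (u n, f n)) ->
  (forall n, `|f n| <= F) -> weak_cvg f fl ->
  exists2 s : nat -> nat, increasing_seq s &
    exists2 ul, u (s n) @[n --> \oo] --> ul & Vad K A j pi (ul, fl).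
Proof.
move=> l0 lc usol fF fw.
have [B uB] := penalized_bounded F.
have [s incs [ul uw]] := bounded_weak_subseq (fun n => uB _ _ _ (l0 n) (usol n) (fF n)).
have lc' : (lambda \o s) n @[n --> \oo] --> 0 := cvg_comp _ _ (cvg_subseq incs) lc.
have fw' := weak_cvg_subseq incs fw.
exists s => //; exists ul.
  exact: (penalized_strong_limit (fun n => l0 (s n)) lc' (fun n => usol (s n))
    (fun n => fF (s n)) fw' uw).
exact: (penalized_limit_Vad (fun n => l0 (s n)) lc' (fun n => usol (s n))
  (fun n => fF (s n)) fw' uw).
Qed.

End PenalizedLimit.

(** * Assumptions along subsequences *)

(** Completes a subsequence of [y] to a whole sequence with values of [d] in the
    gaps, so that assumptions on whole sequences apply to subsequences. *)
Definition splice (T : Type) (s : nat -> nat) (y d : nat -> T) (n : nat) : T :=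
  if `[< exists k, s k = n >] then y n else d n.

Lemma spliceE (T : Type) (s : nat -> nat) (y d : nat -> T) k :
  splice s y d (s k) = y (s k).
Proof. by rewrite /splice asboolT//; exists k. Qed.

Lemma splice_map (T U : Type) (phi : T -> U) (s : nat -> nat) (y d : nat -> T) :
  (fun n => phi (splice s y d n)) = splice s (phi \o y) (phi \o d).
Proof. by apply/funext => n; rewrite /splice; case: ifP. Qed.

Lemma splice_cvg (T : Type) (F : set_system T) (s : nat -> nat) (y d : nat -> T) :
  increasing_seq s -> y (s k) @[k --> \oo] --> F -> d n @[n --> \oo] --> F ->
  splice s y d n @[n --> \oo] --> F.
Proof.
move=> incs yF dF P FP; have [N1 _ H1] := yF P FP; have [N2 _ H2] := dF P FP.
exists (maxn (s N1) N2) => // n /=; rewrite geq_max => /andP[n1 n2].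
rewrite /splice; case: ifP => [/asboolP[k kn]|_]; last exact: H2.
rewrite -kn; apply: H1 => /=; rewrite -kn in n1.
by move: (incs N1 k); rewrite !leEnat n1 => <-.
Qed.

Section AlongSubsequences.
Context (R : realType) (X Y : hilbertType R) (s : nat -> nat).
Context (incs : increasing_seq s).

Lemma cvg_along_subseq (g_ : nat -> X -> R) (g : X -> R) (u : nat -> X) (ul : X) :
  (forall (u_ : nat -> X) (u : X),
     u_ n @[n --> \oo] --> u -> g_ n (u_ n) @[n --> \oo] --> g u) ->
  u (s k) @[k --> \oo] --> ul ->
  g_ (s k) (u (s k)) @[k --> \oo] --> g ul.
Proof.
move=> gcvg uul.
have ulul : (fun=> ul) n @[n --> \oo] --> ul by exact: cvg_cst.
have h := gcvg _ _ (splice_cvg incs uul ulul).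
have h2 := cvg_comp _ _ (cvg_subseq incs) h.
have -> // : (fun k => g_ (s k) (u (s k))) =
  (fun n => g_ n (splice s u (fun=> ul) n)) \o s.
by apply/funext => k /=; rewrite spliceE.
Qed.

Lemma einf_along_subseq (h_ : nat -> Y -> R) (h : Y -> R) (f : nat -> Y) (fl : Y)
    (e : R) :
  (forall (f_ : nat -> Y) (f : Y), weak_cvg f_ f ->
     ((h f)%:E <= limn_einf (fun n => (h_ n (f_ n))%:E))%E) ->
  weak_cvg (f \o s) fl -> 0 < e ->
  \forall k \near \oo, h fl - e < h_ (s k) (f (s k)).
Proof.
move=> hinf ffl e0.
have wf : weak_cvg (splice s f (fun=> fl)) fl.
  move=> phi cphi; rewrite splice_map; apply: splice_cvg => //.
    exact: ffl.
  exact: cvg_cst.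
have [N _ HN] := cvg_subseq incs (limn_einf_ge_near (hinf _ _ wf) e0).
by exists N => // k /HN; rewrite /= spliceE.
Qed.

(** If the values were unbounded, a further subsequence would have norms at
    least [k], and so would the sequence completed by multiples of one of its
    terms; the costs of the completed sequence would tend to infinity although
    they are at most [C] infinitely often. *)
Lemma bounded_along_subseq (h_ : nat -> Y -> R) (f : nat -> Y) (C : R) :
  (forall f_ : nat -> Y,
     `|f_ n| @[n --> \oo] --> +oo -> h_ n (f_ n) @[n --> \oo] --> +oo) ->
  (forall k, h_ (s k) (f (s k)) <= C) -> exists B, forall k, `|f (s k)| <= B.
Proof.
move=> hcoer hC; apply: contrapT => unb.
have far B : exists k, B < `|f (s k)|.
  apply: contrapT => h; apply: unb; exists B => k; rewrite leNgt; apply/negP => ?.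
  by apply: h; exists k.
have [k N|t inct Ht] := @exists_increasing_seq (fun k n => k%:R <= `|f (s n)|).
  have [n Hn] := far (k%:R + \sum_(i < N) `|f (s i)|).
  (* the sum dominates the first N norms, which forces n to be at least N *)
  exists n; last by rewrite (le_trans _ (ltW Hn))// lerDl sumr_ge0.
  rewrite leqNgt; apply/negP => nN; move: Hn; apply/negP; rewrite -leNgt.
  by rewrite (bigD1 (Ordinal nN))//= addrCA lerDl addr_ge0// sumr_ge0.
have incr := increasing_seq_comp incs inct.
have ge_y (a : nat -> R) : (forall n, n%:R <= a n) -> a n @[n --> \oo] --> +oo.
  move=> Ha; apply/cvgryPge => B; have := nbhs_infty_ger B.
  by apply: filterS => n Bn; exact: le_trans (Ha n).
(* the term of index 1 has norm at least 1, so its n-th multiple has norm at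
   least n *)
pose f' := splice (s \o t) f (fun n => n%:R *: f (s (t 1%N))).
have f'y : `|f' n| @[n --> \oo] --> +oo.
  rewrite splice_map; apply: splice_cvg => //; apply: ge_y => n /=.
    exact: Ht.
  by rewrite normrZ normr_nat ler_peMr//; exact: (Ht 1%N).
have /cvgryPgt/(_ C) large := hcoer _ f'y.
have [N _ HN] := cvg_subseq incr large.
have f'E k : f' (s (t k)) = f (s (t k)) by exact: (spliceE (s \o t)).
by have := HN N (leqnn N); rewrite /= f'E ltNge hC.
Qed.

End AlongSubsequences.

(** * Optimal pairs *)

(** Each solution tests the inequality of the other; in the sum the control
    cancels and [alpha < m] forces the distance to vanish. *)
Lemma Vad_unique (R : realType) (X Y : hilbertType R) (K : set X) (A : X -> X)
    (j : X -> X -> R) (pi : {linear X -> Y}) (m alpha : R) u1 u2 f :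
  (forall u v : X, inner (A u - A v) (u - v) >= m * `|u - v| ^+ 2) ->
  (forall eta1 eta2 v1 v2 : X,
     j eta1 v2 - j eta1 v1 + j eta2 v1 - j eta2 v2
       <= alpha * `|eta1 - eta2| * `|v1 - v2|) ->
  alpha < m ->
  Vad K A j pi (u1, f) -> Vad K A j pi (u2, f) -> u1 = u2.
Proof.
move=> Am ja am [K1 H1] [K2 H2].
have h1 := H1 _ K2; have h2 := H2 _ K1.
have h3 := ja u1 u2 u1 u2; have h4 := Am u1 u2.
have : (m - alpha) * `|u1 - u2| ^+ 2 <= 0.
  by move: h1 h2 h3 h4; rewrite !innerE; lra.
rewrite pmulr_rle0 ?subr_gt0// => h.
have : `|u1 - u2| == 0 by rewrite -sqrf_eq0 eq_le h sqr_ge0.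
by rewrite normr_eq0 subr_eq0 => /eqP.
Qed.

(** The operator [A + l^-1 G] inherits strong monotonicity with the same
    constant [m], since [G] is monotone, so [alpha < m] still suffices; the control
    enters through the Riesz representative of [inner f (pi v)]. *)
Lemma penalized_solution_exists (R : realType) (X Y : hilbertType R) (Kt : set X)
    (A G : X -> X) (l : R) (j : X -> X -> R) (pi : {linear X -> Y})
    (m M alpha beta gamma c0 : R) (f : Y) :
  Kt !=set0 -> closed Kt -> @convex_set R X Kt ->
  (forall u v : X, inner (A u - A v) (u - v) >= m * `|u - v| ^+ 2) ->
  (forall u v : X, `|A u - A v| <= M * `|u - v|) ->
  (forall eta : X, @convex_function R X setT (j eta)) ->
  (forall eta1 eta2 v1 v2 : X,
     j eta1 v2 - j eta1 v1 + j eta2 v1 - j eta2 v2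
       <= alpha * `|eta1 - eta2| * `|v1 - v2|) ->
  (forall eta v1 v2 : X,
     j eta v1 - j eta v2 <= (beta + gamma * `|eta|) * `|v1 - v2|) ->
  0 <= alpha -> alpha < m ->
  (forall v : X, `|pi v| <= c0 * `|v|) ->
  monotone_operator G -> lipschitz G -> 0 < l ->
  exists u, Vad_penalized Kt A G l j pi (u, f).
Proof.
move=> Kt0 Ktc Ktv Am AL jc ja jl a0 am pib Gm GL l0.
have [|||z Hz] := @riesz R X (fun v => inner f (pi v)) (`|f| * c0).
- by move=> x y; rewrite linearD innerDr.
- by move=> a x; rewrite linearZ innerZr.
- move=> x; rewrite (le_trans (ler_inner _ _))// -mulrA ler_wpM2l//.
have /pinfty_ex_gt0 [L L0 HL] := GL.
have il0 : 0 < l^-1 by rewrite invr_gt0.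
have [||u Ku Hu] := @quasivariational_solution R X Kt
    (fun u => A u + l^-1 *: G u) j z m (M + l^-1 * L) alpha beta gamma
    Kt0 Ktc Ktv _ _ jc ja jl a0 am.
- move=> u v; have := Am u v.
  have : 0 <= l^-1 * inner (G u - G v) (u - v) by rewrite mulr_ge0 ?(ltW il0).
  by rewrite !innerE; lra.
- move=> u v; have -> : A u + l^-1 *: G u - (A v + l^-1 *: G v) =
      (A u - A v) + l^-1 *: (G u - G v) by rewrite scalerBr opprD addrACA.
  apply: le_trans (ler_normD _ _) _; rewrite mulrDl lerD// normrZ gtr0_norm//.
  by rewrite -mulrA ler_pM2l//; exact: (HL (u, v) (conj Logic.I Logic.I)).
exists u; split=> // v Kv; have := Hu v Kv.
by rewrite -linearB Hz !innerE; lra.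
Qed.

Theorem theorem6 (R : realType) (X Y : hilbertType R)
  (K Kt : set X) (A G : X -> X) (j : X -> X -> R) (pi : {linear X -> Y})
  (lambda : nat -> R)
  (g : X -> R) (g_ : nat -> X -> R) (h : Y -> R) (h_ : nat -> Y -> R)
  (m M alpha beta gamma c0 : R)
  (* (1) *)
  (K_neq0 : K !=set0) (K_closed : closed K) (K_convex : @convex_set R X K)
  (Kt_neq0 : Kt !=set0) (Kt_closed : closed Kt) (Kt_convex : @convex_set R X Kt)
  (K_sub_Kt : K `<=` Kt)
  (* (2) *)
  (m_gt0 : 0 < m) (M_gt0 : 0 < M)
  (A_strongly_monotone : forall u v : X,
     inner (A u - A v) (u - v) >= m * `|u - v| ^+ 2)
  (A_lipschitz : forall u v : X, `|A u - A v| <= M * `|u - v|)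
  (* (3) *)
  (j_convex : forall eta : X, @convex_function R X setT (j eta))
  (j_lsc : forall eta : X, lower_semicontinuous (fun v => (j eta v)%:E))
  (alpha_ge0 : 0 <= alpha)
  (j_alpha : forall eta1 eta2 v1 v2 : X,
     j eta1 v2 - j eta1 v1 + j eta2 v1 - j eta2 v2
       <= alpha * `|eta1 - eta2| * `|v1 - v2|)
  (* (4) *)
  (beta_ge0 : 0 <= beta) (gamma_ge0 : 0 <= gamma)
  (j_beta_gamma : forall eta v1 v2 : X,
     j eta v1 - j eta v2 <= (beta + gamma * `|eta|) * `|v1 - v2|)
  (* (5) *)
  (m_gt_alpha : m > alpha) (m_gt_gamma : m > gamma)
  (* (6) *)
  (j_limsup : forall (eta_ u_ : nat -> X) (eta u : X),
     weak_cvg eta_ eta -> weak_cvg u_ u ->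
     forall v : X,
       (limn_esup (fun n => (j (eta_ n) v - j (eta_ n) (u_ n))%:E)
          <= (j eta v - j eta u)%:E)%E)
  (* (7) *)
  (c0_gt0 : 0 < c0) (pi_bounded : forall v : X, `|pi v| <= c0 * `|v|)
  (pi_weak_strong : forall (v_ : nat -> X) (v : X),
     weak_cvg v_ v -> pi (v_ n) @[n --> \oo] --> pi v)
  (* (8) *)
  (G_monotone : monotone_operator G) (G_lipschitz : lipschitz G)
  (* (9) *)
  (G_le0 : forall u v : X, Kt u -> K v -> inner (G u) (v - u) <= 0)
  (G_eq0 : forall u : X, Kt u ->
     (forall v : X, K v -> inner (G u) (v - u) = 0) -> K u)
  (* (10) *)
  (lambda_gt0 : forall n, 0 < lambda n)
  (lambda_cvg0 : lambda n @[n --> \oo] --> 0)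
  (* (11) *)
  (g_continuous : continuous g) (g_ge0 : forall u, 0 <= g u)
  (g_bounded : maps_bounded_to_bounded g)
  (gn_continuous : forall n, continuous (g_ n))
  (gn_ge0 : forall n u, 0 <= g_ n u)
  (gn_bounded : forall n, maps_bounded_to_bounded (g_ n))
  (* (12) *)
  (h_lsc : weakly_seq_lsc h) (h_coercive : coercive h)
  (hn_lsc : forall n, weakly_seq_lsc (h_ n))
  (hn_coercive : forall n, coercive (h_ n))
  (* (13) *)
  (gn_cvg : forall (u_ : nat -> X) (u : X),
     u_ n @[n --> \oo] --> u -> g_ n (u_ n) @[n --> \oo] --> g u)
  (* (14) *)
  (hn_liminf : forall (f_ : nat -> Y) (f : Y), weak_cvg f_ f ->
     ((h f)%:E <= limn_einf (fun n => (h_ n (f_ n))%:E))%E)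
  (* (15) *)
  (hn_infty : forall f_ : nat -> Y,
     `|f_ n| @[n --> \oo] --> +oo -> h_ n (f_ n) @[n --> \oo] --> +oo)
  (* (16) *)
  (hn_cvg : forall f : Y, h_ n f @[n --> \oo] --> h f)
  (u_star : nat -> X) (f_star : nat -> Y)
  (star_solution : forall n,
     minimizer (cost (g_ n) (h_ n)) (Vad_penalized Kt A G (lambda n) j pi)
       (u_star n, f_star n)) :
  exists2 s : nat -> nat, increasing_seq s &
    exists (u : X) (f : Y),
      [/\ weak_cvg (fun n => f_star (s n)) f,
          u_star (s n) @[n --> \oo] --> u &
          minimizer (cost g h) (Vad K A j pi) (u, f)].
Proof.
have solve n f : exists u, Vad_penalized Kt A G (lambda n) j pi (u, f).
  exact: (penalized_solution_exists f Kt_neq0 Kt_closed Kt_convex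
    A_strongly_monotone A_lipschitz j_convex j_alpha j_beta_gamma alpha_ge0
    m_gt_alpha pi_bounded G_monotone G_lipschitz (lambda_gt0 n)).
have lambda_pos (s : nat -> nat) n : 0 < (lambda \o s) n by exact: lambda_gt0.
have lambda_cvg (s : nat -> nat) : increasing_seq s -> (lambda \o s) n @[n --> \oo] --> 0.
  by move=> incs; exact: cvg_comp _ _ (cvg_subseq incs) lambda_cvg0.
have limit := penalized_limit K_neq0 Kt_closed Kt_convex K_sub_Kt
  A_strongly_monotone A_lipschitz M_gt0 gamma_ge0 j_beta_gamma m_gt0 m_gt_gamma
  j_limsup c0_gt0 pi_bounded pi_weak_strong G_monotone G_lipschitz G_le0 G_eq0.
(* any fixed control has penalized states that converge, along a further
   subsequence, to a state admissible for the limit problem *)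
have competitor f (s : nat -> nat) : increasing_seq s -> exists v : nat -> X,
    (forall n, Vad_penalized Kt A G (lambda n) j pi (v n, f)) /\
    exists2 t : nat -> nat, increasing_seq t & exists2 w, v (s (t k)) @[k --> \oo] --> w &
      Vad K A j pi (w, f).
  move=> incs; have /choice [v Hv] n := solve n f; exists v; split=> //.
  have ff : (fun=> f) n @[n --> \oo] --> f by exact: cvg_cst.
  by have [t inct [w vw Vw]] := limit _ _ (fun=> f) f `|f| (lambda_pos s)
    (lambda_cvg s incs) (fun n => Hv (s n)) (fun=> lexx _)
    (weak_cvg_of_cvg ff); exists t => //; exists w.
have id_inc : increasing_seq (fun n : nat => n) by [].
have [v0 [Hv0 [s0 incs0 [w0 vw0 _]]]] := competitor 0 _ id_inc.
have cost0 : g_ (s0 k) (v0 (s0 k)) + h_ (s0 k) 0 @[k --> \oo] --> g w0 + h 0.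
  have cg := cvg_along_subseq incs0 gn_cvg vw0.
  have ch := cvg_comp _ _ (cvg_subseq incs0) (hn_cvg 0).
  exact: cvgD cg ch.
(* the optimal costs are bounded by those of the zero control *)
have [N _ HN] : \forall k \near \oo,
    g_ (s0 k) (v0 (s0 k)) + h_ (s0 k) 0 <= g w0 + h 0 + 1.
  have /cvgrPdist_lt/(_ _ ltr01) := cost0; apply: filterS => k.
  by rewrite ltr_norml => /andP[]; lra.
pose s1 k := s0 (N + k)%N.
have incs1 : increasing_seq s1.
  by move=> i k; rewrite /s1 incs0 leq_add2l.
have [F HF] : exists F, forall k, `|f_star (s1 k)| <= F.
  apply: (bounded_along_subseq (h_ := h_) (C := g w0 + h 0 + 1) incs1) => // k.
  have [_ /(_ _ (Hv0 (s1 k)))] := star_solution (s1 k); rewrite /cost /= => h1.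
  have := HN (N + k)%N (leq_addr _ _); have := gn_ge0 (s1 k) (u_star (s1 k)).
  by move: h1; rewrite /s1; lra.
have [s2 incs2 [fl Hfl]] := bounded_weak_subseq HF.
have incs12 := increasing_seq_comp incs1 incs2.
have [s3 incs3 [ul uul Vul]] := limit _ _ _ fl F (lambda_pos (s1 \o s2))
  (lambda_cvg _ incs12) (fun n => (star_solution (s1 (s2 n))).1)
  (fun n => HF (s2 n)) Hfl.
have incs := increasing_seq_comp incs12 incs3.
have ffl := weak_cvg_subseq incs3 Hfl.
exists (s1 \o s2 \o s3) => //; exists ul, fl; split=> //; split=> // -[w f] Vw.
(* minimality: compare with penalized states for the control f *)
have [v [Hv [t inct [w' vw' Vw']]]] := competitor f _ incs.
have ww' := Vad_unique A_strongly_monotone j_alpha m_gt_alpha Vw Vw'.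
rewrite -{w' Vw'}ww' in vw'.
have incr := increasing_seq_comp incs inct.
set r := _ \o t in incr.
have gu : g_ (r k) (u_star (r k)) @[k --> \oo] --> g ul.
  have ur := cvg_comp _ _ (cvg_subseq inct) uul.
  exact: (cvg_along_subseq incr gn_cvg ur).
have gv : g_ (r k) (v (r k)) @[k --> \oo] --> g w.
  exact: (cvg_along_subseq incr gn_cvg vw').
have hf : h_ (r k) f @[k --> \oo] --> h f.
  exact: cvg_comp _ _ (cvg_subseq incr) (hn_cvg f).
have fr : weak_cvg (f_star \o r) fl by exact: (weak_cvg_subseq inct ffl).
rewrite /cost /=; apply/ler_addgt0Pr => e e0.
have lhs : g_ (r k) (u_star (r k)) + (h fl - e) @[k --> \oo] --> g ul + (h fl - e).
  by apply: cvgD => //; exact: cvg_cst.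
have rhs : g_ (r k) (v (r k)) + h_ (r k) f @[k --> \oo] --> g w + h f.
  exact: cvgD gv hf.
suff : g ul + (h fl - e) <= g w + h f by lra.
apply: (ler_cvg_to lhs rhs).
have := einf_along_subseq incr hn_liminf fr e0; apply: filterS => k hk.
by have [_ /(_ _ (Hv (r k)))] := star_solution (r k); rewrite /cost /=; lra.
Qed.
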